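(* Let $(\mathcal{L},\phi,\xi,\eta,g)$ be the manifold constructed on a 3-dimensional real connected Lie group as described in the context, and suppose it belongs to a basic class $\mathcal{F}_s$, $s\in\{1,4,5,8,9,10,11\}$, with parameters $\alpha,\beta$ as in the context. If $s=10$, then $(\mathcal{L},\phi,\xi,\eta,g)$ is flat. If $s\neq 10$, then $(\mathcal{L},\phi,\xi,\eta,g)$ is flat if and only if it is an $\mathcal{F}_0$-manifold (i.e. $F=0$). In the case $s\ne 10$, the (possibly) non-zero components of $R$, $\rho$, $\rho^*$ and the (possibly) non-zero values of $\tau$, $\tau^*$, $k_{ij}$ are the following (all others, apart from those obtained by the symmetries of $R$, $\rho$ and $k_{ij}=k_{ji}$, being zero): \begin{itemize} \item $\mathcal{F}_1$: $R_{1212}=-\rho_{11}=-\rho_{22}=\rho^*_{12}=\rho^*_{21}=-\frac12\tau=-k_{12}=\alpha^2+\beta^2$; \item $\mathcal{F}_4$: $R_{0101}=R_{0202}=-R_{1212}=-\frac12\rho_{00}=-\rho^*_{12}=-\rho^*_{21}=-\frac12\tau=-k_{01}=-k_{02}=k_{12}=\alpha^2$; \item $\mathcal{F}_5$: $R_{0101}=R_{0202}=R_{1212}=-\frac12\rho_{00}=-\frac12\rho_{11}=-\frac12\rho_{22}=\rho^*_{12}=\rho^*_{21}=-\frac16\tau=-k_{01}=-k_{02}=-k_{12}=\alpha^2$; \item $\mathcal{F}_8$: $R_{0101}=R_{0202}=-R_{1212}=-\frac12\rho_{00}=-\rho^*_{12}=-\rho^*_{21}=-\frac12\tau=-k_{01}=-k_{02}=k_{12}=-\alpha^2$;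 \item $\mathcal{F}_9$: $R_{0101}=R_{0202}=-R_{1212}=-\frac12\rho_{00}=-\rho^*_{12}=-\rho^*_{21}=-\frac12\tau=-k_{01}=-k_{02}=k_{12}=\alpha^2$; \item $\mathcal{F}_{11}$: $R_{0101}=-\rho_{11}=-k_{01}=\alpha^2$, $\ \rho_{00}=\frac12\tau=-(\alpha^2+\beta^2)$, $\ R_{0102}=-\rho_{12}=-\frac12\rho^*_{00}=-\frac12\tau^*=\alpha\beta$, $\ R_{0202}=-\rho_{22}=-k_{02}=\beta^2$. \end{itemize}
   Context: Let $\mathcal{L}$ be a 3-dimensional real connected Lie group with Lie algebra $\mathfrak{l}$, and let $\{E_0,E_1,E_2\}$ be a basis of left-invariant vector fields. Define left-invariant tensors $\phi$ (type $(1,1)$), $\xi$ (vector field), $\eta$ (1-form), $g$ (Riemannian metric) by $\phi E_0=0$, $\phi E_1=E_2$, $\phi E_2=E_1$, $\xi=E_0$, $\eta(E_0)=1$, $\eta(E_1)=\eta(E_2)=0$, $g(E_i,E_j)=\delta_{ij}$. Let $\nabla$ be the Levi-Civita connection of $g$ and $F(x,y,z)=g((\nabla_x\phi)y,z)$. For $x=x^iE_i$, $y=y^iE_i$, $z=z^iE_i$, the manifold belongs to the basic class $\mathcal{F}_s$ (is an $\mathcal{F}_s$-manifold) if $F=F_s$, where $F_s$ is a tensor of the following form, with real coefficients $\theta_0,\theta_1,\theta_2,\theta_0^*,\lambda,\mu,\nu,\omega_1,\omega_2$: - $F_1(x,y,z)=(x^1\theta_1-x^2\theta_2)(y^1z^1-y^2z^2)$;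 - $F_4(x,y,z)=\frac{\theta_0}{2}\{x^1(y^0z^1+y^1z^0)+x^2(y^0z^2+y^2z^0)\}$; - $F_5(x,y,z)=\frac{\theta^*_0}{2}\{x^1(y^0z^2+y^2z^0)+x^2(y^0z^1+y^1z^0)\}$; - $F_8(x,y,z)=\lambda\{x^1(y^0z^1+y^1z^0)-x^2(y^0z^2+y^2z^0)\}$; - $F_9(x,y,z)=\mu\{x^1(y^0z^2+y^2z^0)-x^2(y^0z^1+y^1z^0)\}$; - $F_{10}(x,y,z)=\nu x^0(y^1z^1-y^2z^2)$; - $F_{11}(x,y,z)=x^0\{\omega_1(y^0z^1+y^1z^0)+\omega_2(y^0z^2+y^2z^0)\}$. The manifold belongs to $\mathcal{F}_0$ if $F=0$. Membership in $\mathcal{F}_s$ means that the brackets have the following form, which defines the real parameters $\alpha,\beta$: - $\mathcal{F}_1$: $[E_0,E_1]=[E_0,E_2]=0$, $[E_1,E_2]=\alpha E_1-\beta E_2$; - $\mathcal{F}_4$: $[E_0,E_1]=\alpha E_2$, $[E_0,E_2]=\alpha E_1$, $[E_1,E_2]=0$; - $\mathcal{F}_5$: $[E_0,E_1]=\alpha E_1$, $[E_0,E_2]=\alpha E_2$, $[E_1,E_2]=0$; - $\mathcal{F}_8$: $[E_0,E_1]=\alpha E_2$, $[E_0,E_2]=-\alpha E_1$, $[E_1,E_2]=2\alpha E_0$; - $\mathcal{F}_9$: $[E_0,E_1]=\alpha E_1$, $[E_0,E_2]=-\alpha E_2$, $[E_1,E_2]=0$; - $\mathcal{F}_{10}$: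 $[E_0,E_1]=-\alpha E_2$, $[E_0,E_2]=\alpha E_1$, $[E_1,E_2]=0$; - $\mathcal{F}_{11}$: $[E_0,E_1]=\alpha E_0$, $[E_0,E_2]=\beta E_0$, $[E_1,E_2]=0$. Curvature conventions: $R(x,y)z=\nabla_x\nabla_yz-\nabla_y\nabla_xz-\nabla_{[x,y]}z$, $R(x,y,z,w)=g(R(x,y)z,w)$, $R_{ijkl}=R(E_i,E_j,E_k,E_l)$. In the orthonormal basis, $\rho(y,z)=\sum_iR(E_i,y,z,E_i)$, $\tau=\sum_i\rho(E_i,E_i)$, $\rho^*(y,z)=\sum_iR(E_i,y,z,\phi E_i)$, $\tau^*=\sum_i\rho^*(E_i,E_i)$, $\rho_{jk}=\rho(E_j,E_k)$, $\rho^*_{jk}=\rho^*(E_j,E_k)$; $k_{ij}$ is the sectional curvature of the plane spanned by $E_i,E_j$ ($i\neq j$), i.e. $k_{ij}=R(E_i,E_j,E_j,E_i)$. Flat means $R=0$. *)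

(* Defs.v *)
From HB Require Import structures.
From mathcomp Require Import all_boot all_order all_algebra.
From mathcomp Require Import all_classical all_reals all_analysis.
Set Implicit Arguments.
Unset Strict Implicit.
Unset Printing Implicit Defensive.
Import Order.TTheory GRing.Theory Num.Theory.
Import numFieldNormedType.Exports.
Local Open Scope classical_set_scope.
Local Open Scope ring_scope.

(* C^oo on D: every iterated directional derivative of f is Frechet
   differentiable at every point of D.  (For D open and V finite-dimensional
   this is the usual notion: all iterated partial derivatives exist and are
   continuous.) *)
Definition smooth_on (R : realType) (V W : normedModType R) (D : set V)
    (f : V -> W) : Prop :=
  forall (vs : seq V) (x : V), D x ->
    differentiable (foldr (fun v (h : V -> W) => 'D_v h) f vs) x.

(* A group carrying a topology; compatibility is part of [lie_group]. *)
#[short(type="groupTopologicalType")]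
HB.structure Definition GroupTopological := {G of Topological G & Group G}.

(* A connected real Lie group of dimension 3.  The smooth structure is given by
   an atlas indexed by the points of the group: [chart p] is a chart around p,
   with domain [dom p] and inverse [chart_inv p] on its (open) image.  [dom p],
   [chart p] and [chart_inv p] are total functions whose values are only
   meaningful on the domain, resp. on the image. *)
Record lie_group (R : realType) := LieGroup {
  carrier :> groupTopologicalType;
  dom : carrier -> set carrier;
  chart : carrier -> carrier -> 'rV[R]_3;
  chart_inv : carrier -> 'rV[R]_3 -> carrier;
  carrier_hausdorff : hausdorff_space carrier;
  carrier_second_countable : @second_countable carrier;
  carrier_connected : connected [set: carrier];
  dom_open : forall p, open (dom p);
  dom_center : forall p, dom p p;
  chart_open : forall p, open (chart p @` dom p);
  chartK : forall p q, dom p q -> chart_inv p (chart p q) = q;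
  chart_continuous : forall p q, dom p q -> {for q, continuous (chart p)};
  chart_inv_continuous : forall p y,
    (chart p @` dom p) y -> {for y, continuous (chart_inv p)};
  chart_transition : forall p q,
    smooth_on (chart p @` (dom p `&` dom q)) (chart q \o chart_inv p);
  mul_continuous : continuous (fun u : carrier * carrier => (u.1 * u.2)%g);
  mul_smooth : forall p q r,
    smooth_on [set u : 'rV[R]_3 * 'rV[R]_3 |
                 [/\ (chart p @` dom p) u.1, (chart q @` dom q) u.2 &
                     dom r (chart_inv p u.1 * chart_inv q u.2)%g]]
              (fun u => chart r (chart_inv p u.1 * chart_inv q u.2)%g);
  inv_continuous : continuous (fun u : carrier => (u^-1)%g);
  inv_smooth : forall p q,
    smooth_on [set u : 'rV[R]_3 |
                 (chart p @` dom p) u /\ dom q ((chart_inv p u)^-1)%g]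
              (fun u => chart q ((chart_inv p u)^-1)%g)
}.

(* The tangent space at p is identified with R^3 through the chart [chart p]
   (the one attached to p), so that a rough vector field is a function to R^3,
   and a tensor field assigns to p a multilinear map on R^3. *)
Definition vfield (R : realType) (G : lie_group R) : Type := G -> 'rV[R]_3.

Section Geometry.
Context {R : realType} {G : lie_group R}.
Implicit Types (f : G -> R) (X Y Z W : vfield G) (p q : G).

Definition smooth_fun (U : set G) f : Prop :=
  forall p, smooth_on (chart p @` (U `&` dom p)) (f \o chart_inv p).

(* The function X f. *)
Definition act X f : G -> R :=
  fun p => 'D_(X p) (f \o chart_inv p) (chart p p).

Definition smooth_field X : Prop :=
  forall (U : set G) f, open U -> smooth_fun U f -> smooth_fun U (act X f).

(* Z = [X, Y]: the two agree as derivations of locally defined functions. *)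
Definition is_lie_bracket X Y Z : Prop :=
  forall (U : set G) f, open U -> smooth_fun U f ->
  forall p, U p -> act Z f p = act X (act Y f) p - act Y (act X f) p.

(* For smooth X and Y such a Z exists and is unique. *)
Definition lie_bracket X Y : vfield G :=
  xget (0 : G -> 'rV[R]_3) [set Z | smooth_field Z /\ is_lie_bracket X Y Z].

(* The differential at p, applied to v, of left translation by a. *)
Definition dtrans (a p : G) (v : 'rV[R]_3) : 'rV[R]_3 :=
  'D_v (fun y => chart (a * p)%g (a * chart_inv p y)%g) (chart p p).

Definition left_invariant X : Prop :=
  smooth_field X /\ forall a p, dtrans a p (X p) = X (a * p)%g.

(* A basis (E_0, E_1, E_2) of the Lie algebra of left-invariant fields. *)
Definition left_invariant_basis (E : 'I_3 -> vfield G) : Prop :=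
  (forall i, left_invariant (E i)) /\
  (forall X, left_invariant X ->
     exists! c : 'rV[R]_3, forall p, X p = \sum_i c 0 i *: E i p).

Record riemannian_metric (g : G -> 'rV[R]_3 -> 'rV[R]_3 -> R) : Prop :=
  RiemannianMetric {
  metric_linear : forall p a u v w, g p (a *: u + v) w = a * g p u w + g p v w;
  metric_sym : forall p u v, g p u v = g p v u;
  metric_pos : forall p u, u != 0 -> 0 < g p u u;
  metric_smooth : forall X Y, smooth_field X -> smooth_field Y ->
    smooth_fun [set: G] (fun p => g p (X p) (Y p))
}.

(* The values of nabla on non-smooth fields are irrelevant. *)
Record levi_civita (g : G -> 'rV[R]_3 -> 'rV[R]_3 -> R)
    (nabla : vfield G -> vfield G -> vfield G) : Prop := LeviCivita {
  nabla_smooth : forall X Y, smooth_field X -> smooth_field Y ->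
    smooth_field (nabla X Y);
  nabla_addl : forall X Y Z,
    smooth_field X -> smooth_field Y -> smooth_field Z ->
    forall p, nabla (fun q => X q + Y q) Z p = nabla X Z p + nabla Y Z p;
  nabla_scalel : forall f X Y,
    smooth_fun [set: G] f -> smooth_field X -> smooth_field Y ->
    forall p, nabla (fun q => f q *: X q) Y p = f p *: nabla X Y p;
  nabla_addr : forall X Y Z,
    smooth_field X -> smooth_field Y -> smooth_field Z ->
    forall p, nabla X (fun q => Y q + Z q) p = nabla X Y p + nabla X Z p;
  nabla_leibniz : forall f X Y,
    smooth_fun [set: G] f -> smooth_field X -> smooth_field Y ->
    forall p, nabla X (fun q => f q *: Y q) p
              = act X f p *: Y p + f p *: nabla X Y p;
  nabla_torsion_free : forall X Y, smooth_field X -> smooth_field Y ->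
    is_lie_bracket X Y (fun q => nabla X Y q - nabla Y X q);
  nabla_metric : forall X Y Z,
    smooth_field X -> smooth_field Y -> smooth_field Z ->
    forall p, act X (fun q => g q (Y q) (Z q)) p
              = g p (nabla X Y p) (Z p) + g p (Y p) (nabla X Z p)
}.

(* phi, xi, eta and g are given by constant components in the left-invariant
   frame E; in particular they are left-invariant. *)
Definition adapted_structure (E : 'I_3 -> vfield G)
    (phi : G -> {linear 'rV[R]_3 -> 'rV[R]_3}) (xi : vfield G)
    (eta : G -> {scalar 'rV[R]_3})
    (g : G -> 'rV[R]_3 -> 'rV[R]_3 -> R) : Prop :=
  [/\ forall p, [/\ phi p (E 0 p) = 0, phi p (E 1 p) = E 2 p
                  & phi p (E 2 p) = E 1 p],
      xi = E 0,
      forall i p, eta p (E i p) = (i == 0)%:R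
    & forall i j p, g p (E i p) (E j p) = (i == j)%:R].

Section Tensors.
Variables (E : 'I_3 -> vfield G) (phi : G -> {linear 'rV[R]_3 -> 'rV[R]_3}).
Variables (g : G -> 'rV[R]_3 -> 'rV[R]_3 -> R).
Variable (nabla : vfield G -> vfield G -> vfield G).

(* F(X, Y, Z) = g((nabla_X phi) Y, Z). *)
Definition Ftensor X Y Z : G -> R :=
  fun p => g p (nabla X (fun q => phi q (Y q)) p - phi p (nabla X Y p)) (Z p).

(* R(X, Y) Z. *)
Definition curvature X Y Z : vfield G :=
  fun p => nabla X (nabla Y Z) p - nabla Y (nabla X Z) p
           - nabla (lie_bracket X Y) Z p.

Definition flat : Prop :=
  forall X Y Z, smooth_field X -> smooth_field Y -> smooth_field Z ->
  forall p, curvature X Y Z p = 0.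

Definition F0_manifold : Prop :=
  forall X Y Z, smooth_field X -> smooth_field Y -> smooth_field Z ->
  forall p, Ftensor X Y Z p = 0.

Definition curvature4 X Y Z W : G -> R :=
  fun p => g p (curvature X Y Z p) (W p).

Definition ricci Y Z : G -> R :=
  fun p => \sum_i curvature4 (E i) Y Z (E i) p.

Definition scal : G -> R := fun p => \sum_i ricci (E i) (E i) p.

Definition ricci_star Y Z : G -> R :=
  fun p => \sum_i curvature4 (E i) Y Z (fun q => phi q (E i q)) p.

Definition scal_star : G -> R := fun p => \sum_i ricci_star (E i) (E i) p.

(* Sectional curvature of the plane spanned by E_i and E_j, for i != j (the
   basis being orthonormal). *)
Definition sectional (i j : 'I_3) : G -> R :=
  curvature4 (E i) (E j) (E j) (E i).

End Tensors.
End Geometry.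

Inductive basic_class := F1 | F4 | F5 | F8 | F9 | F10 | F11.

Record coefficients (R : realType) := Coefficients {
  theta0 : R; theta1 : R; theta2 : R; theta0s : R;
  lam : R; mu : R; nu : R; omega1 : R; omega2 : R
}.

(* F_s(x, y, z) in terms of the components of x, y, z in the basis E. *)
Definition basic_tensor (R : realType) (s : basic_class) (c : coefficients R)
    (x y z : 'I_3 -> R) : R :=
  match s with
  | F1 => (x 1 * theta1 c - x 2 * theta2 c) * (y 1 * z 1 - y 2 * z 2)
  | F4 => theta0 c / 2 * (x 1 * (y 0 * z 1 + y 1 * z 0)
                          + x 2 * (y 0 * z 2 + y 2 * z 0))
  | F5 => theta0s c / 2 * (x 1 * (y 0 * z 2 + y 2 * z 0)
                           + x 2 * (y 0 * z 1 + y 1 * z 0))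
  | F8 => lam c * (x 1 * (y 0 * z 1 + y 1 * z 0)
                   - x 2 * (y 0 * z 2 + y 2 * z 0))
  | F9 => mu c * (x 1 * (y 0 * z 2 + y 2 * z 0)
                  - x 2 * (y 0 * z 1 + y 1 * z 0))
  | F10 => nu c * x 0 * (y 1 * z 1 - y 2 * z 2)
  | F11 => x 0 * (omega1 c * (y 0 * z 1 + y 1 * z 0)
                  + omega2 c * (y 0 * z 2 + y 2 * z 0))
  end.

(* F = F_s, evaluated on fields x = x^i E_i, y = y^i E_i, z = z^i E_i with
   smooth functions x^i, y^i, z^i. *)
Definition in_class (R : realType) (G : lie_group R) (E : 'I_3 -> vfield G)
    (phi : G -> {linear 'rV[R]_3 -> 'rV[R]_3})
    (g : G -> 'rV[R]_3 -> 'rV[R]_3 -> R)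
    (nabla : vfield G -> vfield G -> vfield G) (s : basic_class) : Prop :=
  exists c : coefficients R, forall x y z : 'I_3 -> G -> R,
    (forall i, [/\ smooth_fun [set: G] (x i), smooth_fun [set: G] (y i)
                 & smooth_fun [set: G] (z i)]) ->
    forall p,
      Ftensor phi g nabla (fun q => \sum_i x i q *: E i q)
        (fun q => \sum_i y i q *: E i q) (fun q => \sum_i z i q *: E i q) p
      = basic_tensor s c (x^~ p) (y^~ p) (z^~ p).

(* beta is only used in the classes F_1 and F_11. *)
Definition class_brackets (R : realType) (G : lie_group R)
    (E : 'I_3 -> G -> 'rV[R]_3) (s : basic_class) (alpha beta : R) : Prop :=
  let br i j : G -> 'rV[R]_3 := lie_bracket (E i) (E j) in
  match s with
  | F1 => [/\ br 0 1 = 0, br 0 2 = 0 & br 1 2 = alpha *: E 1 - beta *: E 2]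
  | F4 => [/\ br 0 1 = alpha *: E 2, br 0 2 = alpha *: E 1 & br 1 2 = 0]
  | F5 => [/\ br 0 1 = alpha *: E 1, br 0 2 = alpha *: E 2 & br 1 2 = 0]
  | F8 => [/\ br 0 1 = alpha *: E 2, br 0 2 = - alpha *: E 1
            & br 1 2 = (2 * alpha) *: E 0]
  | F9 => [/\ br 0 1 = alpha *: E 1, br 0 2 = - alpha *: E 2 & br 1 2 = 0]
  | F10 => [/\ br 0 1 = - alpha *: E 2, br 0 2 = alpha *: E 1 & br 1 2 = 0]
  | F11 => [/\ br 0 1 = alpha *: E 0, br 0 2 = beta *: E 0 & br 1 2 = 0]
  end.

Section Components.
Variable R : realType.

Definition all_equal_to (v : R) (s : seq R) : Prop := forall x, x \in s -> x = v.

(* [Rc i j k l] has the symmetries of a curvature tensor and vanishes unless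
   (i, j, k, l) is, up to these symmetries, in the list S. *)
Definition curvature_support (S : seq ('I_3 * 'I_3 * 'I_3 * 'I_3))
    (Rc : 'I_3 -> 'I_3 -> 'I_3 -> 'I_3 -> R) : Prop :=
  [/\ forall i j k l, Rc j i k l = - Rc i j k l,
      forall i j k l, Rc i j l k = - Rc i j k l,
      forall i j k l, Rc k l i j = Rc i j k l
    & forall i j k l,
        (forall t, t \in [:: (i, j, k, l); (j, i, k, l); (i, j, l, k);
                             (j, i, l, k); (k, l, i, j); (l, k, i, j);
                             (k, l, j, i); (l, k, j, i)] -> t \notin S) ->
        Rc i j k l = 0].

Definition symmetric_support (S : seq ('I_3 * 'I_3)) (T : 'I_3 -> 'I_3 -> R)
    : Prop :=
  (forall i j, T i j = T j i) /\
  (forall i j, (i, j) \notin S -> (j, i) \notin S -> T i j = 0).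

Definition plane_support (S : seq ('I_3 * 'I_3)) (k : 'I_3 -> 'I_3 -> R)
    : Prop :=
  (forall i j, i != j -> k i j = k j i) /\
  (forall i j, i != j -> (i, j) \notin S -> (j, i) \notin S -> k i j = 0).

Definition plain_support (S : seq ('I_3 * 'I_3)) (T : 'I_3 -> 'I_3 -> R) : Prop :=
  forall i j, (i, j) \notin S -> T i j = 0.

Definition class_components (s : basic_class) (alpha beta : R)
    (Rc : 'I_3 -> 'I_3 -> 'I_3 -> 'I_3 -> R) (rho rhos : 'I_3 -> 'I_3 -> R)
    (tau taus : R) (k : 'I_3 -> 'I_3 -> R) : Prop :=
  match s with
  | F1 =>
    [/\ all_equal_to (alpha ^+ 2 + beta ^+ 2)
          [:: Rc 1 2 1 2; - rho 1 1; - rho 2 2; rhos 1 2; rhos 2 1;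
              - (1 / 2 * tau); - k 1 2],
        curvature_support [:: (1, 2, 1, 2)] Rc,
        symmetric_support [:: (1, 1); (2, 2)] rho /\
        plain_support [:: (1, 2); (2, 1)] rhos,
        taus = 0
      & plane_support [:: (1, 2)] k]
  | F4 | F9 =>
    [/\ all_equal_to (alpha ^+ 2)
          [:: Rc 0 1 0 1; Rc 0 2 0 2; - Rc 1 2 1 2; - (1 / 2 * rho 0 0);
              - rhos 1 2; - rhos 2 1; - (1 / 2 * tau);
              - k 0 1; - k 0 2; k 1 2],
        curvature_support [:: (0, 1, 0, 1); (0, 2, 0, 2); (1, 2, 1, 2)] Rc,
        symmetric_support [:: (0, 0)] rho /\
        plain_support [:: (1, 2); (2, 1)] rhos,
        taus = 0
      & plane_support [:: (0, 1); (0, 2); (1, 2)] k]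
  | F5 =>
    [/\ all_equal_to (alpha ^+ 2)
          [:: Rc 0 1 0 1; Rc 0 2 0 2; Rc 1 2 1 2; - (1 / 2 * rho 0 0);
              - (1 / 2 * rho 1 1); - (1 / 2 * rho 2 2); rhos 1 2; rhos 2 1;
              - (1 / 6 * tau); - k 0 1; - k 0 2; - k 1 2],
        curvature_support [:: (0, 1, 0, 1); (0, 2, 0, 2); (1, 2, 1, 2)] Rc,
        symmetric_support [:: (0, 0); (1, 1); (2, 2)] rho /\
        plain_support [:: (1, 2); (2, 1)] rhos,
        taus = 0
      & plane_support [:: (0, 1); (0, 2); (1, 2)] k]
  | F8 =>
    [/\ all_equal_to (- alpha ^+ 2)
          [:: Rc 0 1 0 1; Rc 0 2 0 2; - Rc 1 2 1 2; - (1 / 2 * rho 0 0);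
              - rhos 1 2; - rhos 2 1; - (1 / 2 * tau);
              - k 0 1; - k 0 2; k 1 2],
        curvature_support [:: (0, 1, 0, 1); (0, 2, 0, 2); (1, 2, 1, 2)] Rc,
        symmetric_support [:: (0, 0)] rho /\
        plain_support [:: (1, 2); (2, 1)] rhos,
        taus = 0
      & plane_support [:: (0, 1); (0, 2); (1, 2)] k]
  | F11 =>
    [/\ [/\ all_equal_to (alpha ^+ 2) [:: Rc 0 1 0 1; - rho 1 1; - k 0 1],
            all_equal_to (- (alpha ^+ 2 + beta ^+ 2)) [:: rho 0 0; 1 / 2 * tau],
            all_equal_to (alpha * beta)
              [:: Rc 0 1 0 2; - rho 1 2; - (1 / 2 * rhos 0 0);
                  - (1 / 2 * taus)]
          & all_equal_to (beta ^+ 2) [:: Rc 0 2 0 2; - rho 2 2; - k 0 2]],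
        curvature_support [:: (0, 1, 0, 1); (0, 1, 0, 2); (0, 2, 0, 2)] Rc,
        symmetric_support [:: (0, 0); (1, 1); (1, 2); (2, 2)] rho,
        plain_support [:: (0, 0)] rhos
      & plane_support [:: (0, 1); (0, 2)] k]
  | F10 => True
  end.

End Components.

(* Main.v *)
(* In an orthonormal frame with constant structure constants, the Levi-Civita
   connection has constant components Gamma i j k = g(nabla_{E_i} E_j, E_k),
   determined by skewness in (j, k) and by [E_i, E_j] = nabla_{E_i} E_j -
   nabla_{E_j} E_i; curvature and F are then explicit quadratic and linear
   expressions in Gamma.  The existence of the bracket of two smooth fields
   comes for free from the torsion-free connection, and its uniqueness from
   evaluating derivations on coordinate functions.  Both curvature and F are
   C^oo-linear, so each vanishes iff its frame components do; for s <> 10 either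
   condition forces alpha (and beta, in F_1 and F_11) to be zero. *)
Require Import Defs.
From mathcomp Require Import all_boot all_order all_algebra.
From mathcomp Require Import all_classical all_reals all_analysis.
From mathcomp Require Import ring lra.
Set Implicit Arguments.
Unset Strict Implicit.
Unset Printing Implicit Defensive.
Import Order.TTheory GRing.Theory Num.Theory.
Import numFieldNormedType.Exports.
Local Open Scope classical_set_scope.
Local Open Scope ring_scope.

(** * Smooth functions *)

Section Smooth.
Context {R : realType}.

(** The first-order expansion of [f] at [x] is also one of [h], because the two agree near [x];
    uniqueness of the differential then identifies ['d h x] with ['d f x]. *)
Lemma near_eq_differentiable (V W : normedModType R) (f h : V -> W) x :
  (\near x, f x = h x) -> differentiable f x -> differentiable h x.
Proof.
move=> fh df; have fhx : f x = h x := nbhs_singleton fh.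
have dh : h \o shift x = cst (h x) + 'd f x +o_ 0 id.
  apply/eqaddoP => e e0.
  have /eqaddoP/(_ e e0) := diff_locally df.
  have fh0 : \forall y \near (0 : V), f (y + x) = h (y + x).
    by move: fh; rewrite (near_shift 0) subr0.
  apply: filterS2 fh0 => y fhy.
  by rewrite !fctE /= fhy fhx.
have dE := diff_unique (diff_continuous df) dh.
by apply/diff_locallyP; rewrite dE; split => //; exact: diff_continuous.
Qed.

Context {V : normedModType R}.
Implicit Types D : set V.

(* [smooth_on] sliced by the order of differentiation, so that the product rule
   can be iterated by induction. *)
Fixpoint Ck (W : normedModType R) D (n : nat) (f : V -> W) : Prop :=
  (forall x, D x -> differentiable f x) /\
  if n is n'.+1 then forall v, Ck D n' ('D_v f) else True.

Lemma Ck_differentiable (W : normedModType R) D n (f : V -> W) x :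
  Ck D n f -> D x -> differentiable f x.
Proof. by case: n => [|n] [df _]; exact: df. Qed.

Lemma CkS (W : normedModType R) D n (f : V -> W) : Ck D n.+1 f -> Ck D n f.
Proof.
elim: n f => [|n IHn] f [df Df]; split=> // v.
exact: IHn (Df v).
Qed.

(** The last element of the list in [smooth_on] is the direction of the innermost derivative, so
    peeling lists from the end matches the recursion of [Ck]. *)
Lemma smooth_on_Ck (W : normedModType R) D (f : V -> W) :
  smooth_on D f <-> forall n, Ck D n f.
Proof.
split=> [sf n|Cf vs].
  elim: n f sf => [|n IHn] f sf; split => //; try exact: (sf [::]).
  move=> v; apply: IHn => vs x Dx.
  by have := sf (rcons vs v) x Dx; rewrite foldr_rcons.
elim/last_ind: vs f Cf => [|vs v IHvs] f Cf x Dx.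
  exact: Ck_differentiable (Cf 0%N) Dx.
rewrite foldr_rcons; apply: IHvs => // n.
by have [_] := Cf n.+1; apply.
Qed.

Lemma smooth_on_differentiable (W : normedModType R) D (f : V -> W) x :
  smooth_on D f -> D x -> differentiable f x.
Proof. by move=> /(_ [::]); apply. Qed.

Lemma smooth_on_subset (W : normedModType R) D D' (f : V -> W) :
  D' `<=` D -> smooth_on D f -> smooth_on D' f.
Proof. by move=> D'D sf vs x /D'D; exact: sf. Qed.

Lemma open_near_eq (W : normedModType R) D (f h : V -> W) x :
  open D -> {in D, f =1 h} -> D x -> \near x, f x = h x.
Proof.
move=> oD fh Dx; have : \forall y \near x, D y by exact: open_nbhs_nbhs.
by apply: filterS => y Dy; apply: fh; rewrite inE.
Qed.

(** On an open set, agreement on [D] is agreement near each of its points and so passes to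
    directional derivatives. This lets the sum and product rules, valid only on [D], be used under
    further derivatives. *)
Lemma eq_Ck (W : normedModType R) D n (f h : V -> W) : open D ->
  {in D, f =1 h} -> Ck D n f -> Ck D n h.
Proof.
move=> oD; elim: n f h => [|n IHn] f h fh Cf.
  split=> // x Dx; apply: near_eq_differentiable (Ck_differentiable Cf Dx).
  exact: open_near_eq fh Dx.
split=> [x Dx|v].
  apply: near_eq_differentiable (Ck_differentiable Cf Dx).
  exact: open_near_eq fh Dx.
have [_ /(_ v)] := Cf; apply: IHn => x /[!inE] Dx.
by apply: near_eq_derive; exact: open_near_eq fh Dx.
Qed.

Lemma eq_smooth_on (W : normedModType R) D (f h : V -> W) : open D ->
  {in D, f =1 h} -> smooth_on D f -> smooth_on D h.
Proof.
by move=> oD fh /smooth_on_Ck Cf; apply/smooth_on_Ck => n; exact: eq_Ck (Cf n).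
Qed.

Lemma CkD (W : normedModType R) D n (f h : V -> W) : open D ->
  Ck D n f -> Ck D n h -> Ck D n (f + h).
Proof.
move=> oD; elim: n f h => [|n IHn] f h Cf Ch; (split=> [x Dx|];
  first by apply: differentiableD; [case: Cf => + _|case: Ch => + _]; apply).
  exact: I.
move=> v; have [_ /(_ v) Cfv] := Cf; have [_ /(_ v) Chv] := Ch.
apply: (@eq_Ck _ _ _ ('D_v f + 'D_v h)) => //; last exact: IHn.
move=> x /[!inE] Dx; rewrite fctE deriveD //; apply: diff_derivable.
  exact: Ck_differentiable Cf Dx.
exact: Ck_differentiable Ch Dx.
Qed.

Lemma CkM D n (f h : V -> R) : open D ->
  Ck D n f -> Ck D n h -> Ck D n (f * h).
Proof.
move=> oD; elim: n f h => [|n IHn] f h Cf Ch; (split=> [x Dx|];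
  first by apply: differentiableM; [case: Cf => + _|case: Ch => + _]; apply).
  exact: I.
move=> v; have [_ /(_ v) Cfv] := Cf; have [_ /(_ v) Chv] := Ch.
apply: (@eq_Ck _ _ _ (f * 'D_v h + h * 'D_v f)) => //; last first.
  by apply: CkD => //; apply: IHn => //; exact: CkS.
move=> x /[!inE] Dx; rewrite !fctE deriveM //; apply: diff_derivable.
  exact: Ck_differentiable Cf Dx.
exact: Ck_differentiable Ch Dx.
Qed.

Lemma smooth_onD (W : normedModType R) D (f h : V -> W) : open D ->
  smooth_on D f -> smooth_on D h -> smooth_on D (f + h).
Proof.
move=> oD /smooth_on_Ck Cf /smooth_on_Ck Ch.
by apply/smooth_on_Ck => n; exact: CkD.
Qed.

Lemma smooth_onM D (f h : V -> R) : open D ->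
  smooth_on D f -> smooth_on D h -> smooth_on D (f * h).
Proof.
move=> oD /smooth_on_Ck Cf /smooth_on_Ck Ch.
by apply/smooth_on_Ck => n; exact: CkM.
Qed.

Lemma smooth_on_cst (W : normedModType R) D (c : W) : smooth_on D (cst c : V -> W).
Proof.
suff H (vs : seq V) : exists c',
    foldr (fun v (h : V -> W) => 'D_v h) (cst c) vs = cst c'.
  by move=> vs x Dx; have [c' ->] := H vs; exact: differentiable_cst.
elim: vs => [|v vs [c' IHvs]]; first by exists c.
by exists 0; rewrite /= IHvs; apply/funext => x; rewrite derive_cst.
Qed.

Lemma smooth_on_coord D m n (f : V -> 'M[R]_(m, n)) i j : open D ->
  smooth_on D f -> smooth_on D (fun x => f x i j).
Proof.
move=> oD /smooth_on_Ck Cf; apply/smooth_on_Ck => k.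
elim: k f {Cf}(Cf k) => [|k IHk] f Cf; split=> //.
- move=> x Dx; apply: (@differentiable_comp _ _ _ _ f (fun N : 'M[R]_(m, n) => N i j)).
    by case: Cf => + _; apply.
  exact: differentiable_coord.
- move=> x Dx; apply: (@differentiable_comp _ _ _ _ f (fun N : 'M[R]_(m, n) => N i j)).
    exact: Ck_differentiable Cf Dx.
  exact: differentiable_coord.
move=> v; have [_ /(_ v) Cfv] := Cf.
apply: eq_Ck (IHk _ Cfv) => // x /[!inE] Dx.
rewrite derive_mx ?mxE //; apply: diff_derivable.
exact: Ck_differentiable Cf Dx.
Qed.

End Smooth.

(** * Vector fields on a Lie group *)

Section Manifold.
Context {R : realType} {G : lie_group R}.
Implicit Types (f h : G -> R) (X Y Z : vfield G) (p q : G) (U : set G).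

(** Near a point of the image, [chart_inv p] is continuous and pulls [U] back to a neighbourhood.
    This supplies the openness on which [eq_smooth_on] and the product rule rely. *)
Lemma chart_image_open U p : open U -> open (chart p @` (U `&` dom p)).
Proof.
move=> oU; rewrite openE => _ [q [Uq dq] <-].
have im_q : (chart p @` dom p) (chart p q) by exists q.
have near_im : \forall y \near chart p q, (chart p @` dom p) y.
  by apply: open_nbhs_nbhs; split => //; exact: chart_open.
have near_U : \forall y \near chart p q, (U `&` dom p) (chart_inv p y).
  apply: (chart_inv_continuous im_q); rewrite chartK //.
  by apply: open_nbhs_nbhs; split => //; apply: openI => //; exact: dom_open.
apply: filterS2 near_im near_U => _ [q' dq' <-]; rewrite chartK // => Uq'; exists q'.
Qed.

Lemma smooth_fun_at U f p : smooth_fun U f -> U p ->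
  differentiable (f \o chart_inv p) (chart p p).
Proof.
move=> sf Up; apply: smooth_on_differentiable (sf p) _.
by exists p => //; split => //; exact: dom_center.
Qed.

Lemma smooth_fun_subset U U' f : U' `<=` U -> smooth_fun U f -> smooth_fun U' f.
Proof.
move=> U'U sf p; apply: smooth_on_subset (sf p).
by move=> _ [q [/U'U Uq dq] <-]; exists q.
Qed.

Lemma eq_smooth_fun U f h : open U ->
  (forall p, U p -> f p = h p) -> smooth_fun U f -> smooth_fun U h.
Proof.
move=> oU fh sf p; apply: eq_smooth_on (sf p); first exact: chart_image_open.
by move=> _ /[!inE] -[q [Uq dq] <-] /=; rewrite chartK // fh.
Qed.

Lemma smooth_fun_cst U (c : R) : smooth_fun U (fun=> c : R).
Proof. by move=> p; exact: smooth_on_cst. Qed.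

Lemma smooth_funD U f h : open U -> smooth_fun U f -> smooth_fun U h ->
  smooth_fun U (fun p => f p + h p).
Proof.
move=> oU sf sh p.
have := smooth_onD (chart_image_open oU) (sf p) (sh p).
exact.

Qed.

Lemma smooth_funM U f h : open U -> smooth_fun U f -> smooth_fun U h ->
  smooth_fun U (fun p => f p * h p).
Proof.
move=> oU sf sh p.
have := smooth_onM (chart_image_open oU) (sf p) (sh p).
exact.

Qed.

Lemma smooth_fun_coord p i : smooth_fun (dom p) (fun q => chart p q 0 i).
Proof.
move=> q; apply: (@smooth_on_coord _ _ _ _ _ (chart p \o chart_inv q)).
  exact: chart_image_open (dom_open p).
by rewrite setIC; exact: chart_transition.
Qed.

(** Read in the chart at [p], a coordinate function is a linear projection near [chart p p]. A field
    is thus recovered from its action on functions. *)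
Lemma act_coord X p i : act X (fun q => chart p q 0 i) p = X p 0 i.
Proof.
have near_id : \forall y \near chart p p,
    ((y : 'rV[R]_3) 0 i : R) = chart p (chart_inv p y) 0 i.
  have im_p : (chart p @` dom p) (chart p p) by exists p => //; exact: dom_center.
  have : \forall y \near chart p p, (chart p @` dom p) y.
    by apply: open_nbhs_nbhs; split => //; exact: chart_open.
  by apply: filterS => _ [q dq <-]; rewrite chartK.
rewrite /act -(near_eq_derive (X p) near_id).
transitivity (('D_(X p) id (chart p p) : 'rV[R]_3) 0 i).
  by rewrite derive_mx ?mxE //; exact: derivable_id.
by rewrite derive_id.
Qed.

Lemma act_cst X (c : R) p : act X (fun=> c) p = 0.
Proof. exact: derive_cst. Qed.

Lemma act_linear U h f X Y p : smooth_fun U h -> U p ->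
  act (fun q => f q *: X q + Y q) h p = f p * act X h p + act Y h p.
Proof.
move=> sh Up; have dh := smooth_fun_at sh Up.
by rewrite /act !deriveE // linearP.
Qed.

Lemma smooth_field_linear f X Y :
  smooth_fun [set: G] f -> smooth_field X -> smooth_field Y ->
  smooth_field (fun q => f q *: X q + Y q).
Proof.
move=> sf sX sY U h oU sh.
apply: (@eq_smooth_fun _ (fun p => f p * act X h p + act Y h p)) => //.
  by move=> p Up; rewrite (act_linear _ _ _ sh).
apply: smooth_funD => //; last exact: sY.
apply: smooth_funM => //; last exact: sX.
exact: smooth_fun_subset sf.
Qed.

Lemma smooth_field0 : smooth_field (0 : vfield G).
Proof.
move=> U h oU sh; apply: (@eq_smooth_fun _ (fun=> 0)) => //.
  by move=> p Up; rewrite /act derive0.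
exact: smooth_fun_cst.
Qed.

Lemma smooth_fieldZ f X : smooth_fun [set: G] f -> smooth_field X ->
  smooth_field (fun q => f q *: X q).
Proof.
move=> sf sX; have := smooth_field_linear sf sX smooth_field0.
by congr smooth_field; apply/funext => p; rewrite addr0.
Qed.

Lemma smooth_fieldD X Y :
  smooth_field X -> smooth_field Y -> smooth_field (fun q => X q + Y q).
Proof.
move=> sX sY; have := smooth_field_linear (smooth_fun_cst 1) sX sY.
by congr smooth_field; apply/funext => p; rewrite scale1r.
Qed.

Lemma is_lie_bracket_unique X Y Z Z' :
  is_lie_bracket X Y Z -> is_lie_bracket X Y Z' -> Z = Z'.
Proof.
move=> XYZ XYZ'; apply/funext => p; apply/rowP => i.
rewrite -[LHS]act_coord -[RHS]act_coord.
by rewrite (XYZ (dom p)) ?(XYZ' (dom p)) //;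
  do ?[exact: dom_open|exact: smooth_fun_coord|exact: dom_center].
Qed.

End Manifold.

(** * The Levi-Civita connection *)

Section LeviCivita.
Context {R : realType} {G : lie_group R}.
Context {g : G -> 'rV[R]_3 -> 'rV[R]_3 -> R}.
Context {nabla : vfield G -> vfield G -> vfield G}.
Hypothesis lc : levi_civita g nabla.
Implicit Types (f : G -> R) (X Y Z : vfield G).

Lemma nabla_linearl f X Y Z : smooth_fun [set: G] f ->
  smooth_field X -> smooth_field Y -> smooth_field Z ->
  nabla (fun q => f q *: X q + Y q) Z
  = fun p => f p *: nabla X Z p + nabla Y Z p.
Proof.
move=> sf sX sY sZ; apply/funext => p.
by rewrite (nabla_addl lc (smooth_fieldZ sf sX)) // (nabla_scalel lc).
Qed.

Lemma nabla_linearr f X Y Z : smooth_fun [set: G] f ->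
  smooth_field X -> smooth_field Y -> smooth_field Z ->
  nabla X (fun q => f q *: Y q + Z q)
  = fun p => act X f p *: Y p + (f p *: nabla X Y p + nabla X Z p).
Proof.
move=> sf sX sY sZ; apply/funext => p.
by rewrite (nabla_addr lc sX (smooth_fieldZ sf sY)) // (nabla_leibniz lc) // addrA.
Qed.

(** Torsion-freeness exhibits a smooth field satisfying the bracket equation, and uniqueness forces
    the choice made by [xget] to be that field rather than the default 0. *)
Lemma lie_bracket_nabla X Y : smooth_field X -> smooth_field Y ->
  lie_bracket X Y = fun q => nabla X Y q - nabla Y X q.
Proof.
move=> sX sY; apply: xget_unique.
  split; last exact: (nabla_torsion_free lc).
  have := smooth_field_linear (smooth_fun_cst (-1)) (nabla_smooth lc sY sX)
    (nabla_smooth lc sX sY).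
  by congr smooth_field; apply/funext => p; rewrite scaleN1r addrC.
by move=> Z [_ XYZ]; apply: is_lie_bracket_unique XYZ (nabla_torsion_free lc _ _).
Qed.

Lemma lie_bracket_anti X Y : smooth_field X -> smooth_field Y ->
  lie_bracket X Y = fun p => - lie_bracket Y X p.
Proof.
move=> sX sY; rewrite (lie_bracket_nabla sX sY) (lie_bracket_nabla sY sX).
by apply/funext => p; rewrite opprB.
Qed.

Lemma nablaBl X Y Z : smooth_field X -> smooth_field Y -> smooth_field Z ->
  nabla (fun q => X q - Y q) Z = fun p => nabla X Z p - nabla Y Z p.
Proof.
move=> sX sY sZ.
have -> : (fun q => X q - Y q) = fun q => (fun=> -1) q *: Y q + X q.
  by apply/funext => q; rewrite scaleN1r addrC.
rewrite (nabla_linearl (smooth_fun_cst (-1)) sY sX sZ).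
by apply/funext => p; rewrite scaleN1r addrC.
Qed.

Lemma curvatureE X Y Z :
  smooth_field X -> smooth_field Y -> smooth_field Z ->
  curvature nabla X Y Z = fun p => nabla X (nabla Y Z) p - nabla Y (nabla X Z) p
    - (nabla (nabla X Y) Z p - nabla (nabla Y X) Z p).
Proof.
move=> sX sY sZ; rewrite /curvature (lie_bracket_nabla sX sY).
by rewrite (nablaBl (nabla_smooth lc sX sY) (nabla_smooth lc sY sX) sZ).
Qed.

Lemma curvature_anti X Y Z p :
  smooth_field X -> smooth_field Y -> smooth_field Z ->
  curvature nabla X Y Z p = - curvature nabla Y X Z p.
Proof.
move=> sX sY sZ; rewrite (curvatureE sX sY sZ) (curvatureE sY sX sZ).
by apply/rowP => i; rewrite !mxE; ring.
Qed.

(** The term -(Yf) nabla_X Z from differentiating f nabla_X Z along Y cancels the term (Yf) nabla_X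
    Z from the bracket part. *)
Lemma curvature_linear1 f X X' Y Z p : smooth_fun [set: G] f ->
  smooth_field X -> smooth_field X' -> smooth_field Y -> smooth_field Z ->
  curvature nabla (fun q => f q *: X q + X' q) Y Z p
  = f p *: curvature nabla X Y Z p + curvature nabla X' Y Z p.
Proof.
move=> sf sX sX' sY sZ.
have sYf : smooth_fun [set: G] (act Y f) by exact: sY openT sf.
have ns := nabla_smooth lc.
have sV := smooth_field_linear sf (ns _ _ sY sX) (ns _ _ sY sX').
rewrite (curvatureE sX sY sZ) (curvatureE sX' sY sZ).
rewrite (curvatureE (smooth_field_linear sf sX sX') sY sZ).
rewrite (nabla_linearl sf sX sX' (ns _ _ sY sZ)) (nabla_linearl sf sX sX' sZ).
rewrite (nabla_linearr sf sY (ns _ _ sX sZ) (ns _ _ sX' sZ)).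
rewrite (nabla_linearl sf sX sX' sY) (nabla_linearr sf sY sX sX').
rewrite (nabla_linearl sf (ns _ _ sX sY) (ns _ _ sX' sY) sZ).
rewrite (nabla_linearl sYf sX sV sZ).
rewrite (nabla_linearl sf (ns _ _ sY sX) (ns _ _ sY sX') sZ).
by apply/rowP => i; rewrite !mxE; ring.
Qed.

Lemma curvature_linear2 f X Y Y' Z p : smooth_fun [set: G] f ->
  smooth_field X -> smooth_field Y -> smooth_field Y' -> smooth_field Z ->
  curvature nabla X (fun q => f q *: Y q + Y' q) Z p
  = f p *: curvature nabla X Y Z p + curvature nabla X Y' Z p.
Proof.
move=> sf sX sY sY' sZ.
rewrite (curvature_anti _ sX (smooth_field_linear sf sY sY') sZ).
rewrite (curvature_linear1 _ sf sY sY' sX sZ) opprD -scalerN.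
congr (_ *: _ + _); apply: esym; first exact: curvature_anti sX sY sZ.
exact: curvature_anti sX sY' sZ.
Qed.

(** Terms with one derivative of f falling on nabla Z cancel in pairs; what remains is X(Yf) - Y(Xf)
    minus the bracket of X and Y applied to f, all times Z, and torsion-freeness makes it vanish. *)
Lemma curvature_linear3 f X Y Z Z' p : smooth_fun [set: G] f ->
  smooth_field X -> smooth_field Y -> smooth_field Z -> smooth_field Z' ->
  curvature nabla X Y (fun q => f q *: Z q + Z' q) p
  = f p *: curvature nabla X Y Z p + curvature nabla X Y Z' p.
Proof.
move=> sf sX sY sZ sZ'.
have sXf : smooth_fun [set: G] (act X f) by exact: sX openT sf.
have sYf : smooth_fun [set: G] (act Y f) by exact: sY openT sf.
have ns := nabla_smooth lc.
have sVY := smooth_field_linear sf (ns _ _ sY sZ) (ns _ _ sY sZ').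
have sVX := smooth_field_linear sf (ns _ _ sX sZ) (ns _ _ sX sZ').
(* Torsion-freeness evaluated on f itself; [nabla X Y] is split as [V] plus [nabla Y X] by linearity
   in the direction. *)
have br : act (nabla X Y) f p =
    act X (act Y f) p - act Y (act X f) p + act (nabla Y X) f p.
  rewrite -(nabla_torsion_free lc sX sY openT sf I).
  pose V : vfield G := fun q => nabla X Y q - nabla Y X q.
  have := @act_linear _ _ _ _ (fun=> 1) V (nabla Y X) p sf I.
  rewrite mul1r => <-; congr (act _ f p).
  by apply/funext => q; rewrite scale1r subrK.
rewrite (curvatureE sX sY sZ) (curvatureE sX sY sZ').
rewrite (curvatureE sX sY (smooth_field_linear sf sZ sZ')).
rewrite (nabla_linearr sf sY sZ sZ') (nabla_linearr sf sX sZ sZ').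
rewrite (nabla_linearr sf (ns _ _ sX sY) sZ sZ').
rewrite (nabla_linearr sf (ns _ _ sY sX) sZ sZ').
rewrite (nabla_linearr sYf sX sZ sVY) (nabla_linearr sXf sY sZ sVX).
rewrite (nabla_linearr sf sX (ns _ _ sY sZ) (ns _ _ sY sZ')).
rewrite (nabla_linearr sf sY (ns _ _ sX sZ) (ns _ _ sX sZ')).
rewrite br; apply/rowP => i; rewrite !mxE.
move: (act X (act Y f) p) (act Y (act X f) p) (act (nabla Y X) f p) => a b c.
by ring.
Qed.

End LeviCivita.

(** * Constant connection components *)

Lemma ord3_cases (i : 'I_3) : [\/ i = 0, i = 1 | i = 2].
Proof.
case: i => -[|[|[|//]]] lt_i3; [apply: Or31|apply: Or32|apply: Or33];
  exact: val_inj.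
Qed.

Lemma sum_ord3 (V : nmodType) (F : 'I_3 -> V) :
  \sum_i F i = F 0 + F 1 + F 2.
Proof.
rewrite !big_ord_recl big_ord0 addr0 addrA.
by congr (F _ + F _ + F _); exact: val_inj.
Qed.

Section Components.
Context {R : realType}.
Implicit Types (s : basic_class) (a b : R).

(* [Gamma i j k] stands for the component g(nabla_{E_i} E_j, E_k). *)
Implicit Types Gamma : 'I_3 -> 'I_3 -> 'I_3 -> R.

(** R_{ijkl} for constant connection components; the last two sums expand the bracket of E_i and E_j
    through torsion-freeness. *)
Definition riemann Gamma i j k l : R :=
  \sum_m Gamma j k m * Gamma i m l - \sum_m Gamma i k m * Gamma j m l
  - (\sum_m Gamma i j m * Gamma m k l - \sum_m Gamma j i m * Gamma m k l).

Definition phi_coef (i j : 'I_3) : R :=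
  ((i == 1) && (j == 2) || (i == 2) && (j == 1))%:R.

(** The frame component F(E_i, E_j, E_k). *)
Definition nabla_phi Gamma i j k : R :=
  \sum_m phi_coef j m * Gamma i m k - \sum_m Gamma i j m * phi_coef m k.

(** The (i, j) component of the 2-form e^a /\ e^b. *)
Definition wedge (a b i j : 'I_3) : R :=
  ((i == a) && (j == b))%:R - ((i == b) && (j == a))%:R.

Lemma wedge_anti (a b i j : 'I_3) : wedge a b j i = - wedge a b i j.
Proof. by rewrite /wedge opprB ![(j == _) && _]andbC. Qed.

Lemma wedge_neq0 (a b i j : 'I_3) :
  wedge a b i j != 0 -> (i, j) = (a, b) \/ (i, j) = (b, a).
Proof.
rewrite /wedge; case: (altP andP) => [[/eqP-> /eqP->]|_]; first by left.
case: (altP andP) => [[/eqP-> /eqP->]|_]; first by right.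
by rewrite subrr eqxx.
Qed.

Definition coords (x y z : R) (k : 'I_3) : R := nth 0 [:: x; y; z] k.

(* Metric compatibility makes every [Gamma i] a 2-form; [u], [v] and [w] are its
   components along E_0 /\ E_1, E_0 /\ E_2 and E_1 /\ E_2 as functions of [i]. *)
Definition connection_form (u v w : 'I_3 -> R) i j k : R :=
  u i * wedge 0 1 j k + v i * wedge 0 2 j k + w i * wedge 1 2 j k.

(** The solution of the Koszul formula for the brackets of each class. It is justified afterwards by
    its skewness and by the brackets it reproduces. *)
Definition class_connection s a b :=
  match s with
  | F1 => connection_form (coords 0 0 0) (coords 0 0 0) (coords 0 (- a) b)
  | F4 => connection_form (coords 0 0 (- a)) (coords 0 (- a) 0) (coords 0 0 0)
  | F5 => connection_form (coords 0 (- a) 0) (coords 0 0 (- a)) (coords 0 0 0)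
  | F8 => connection_form (coords 0 0 a) (coords 0 (- a) 0) (coords 0 0 0)
  | F9 => connection_form (coords 0 (- a) 0) (coords 0 0 a) (coords 0 0 0)
  | F10 => connection_form (coords 0 0 0) (coords 0 0 0) (coords (- a) 0 0)
  | F11 => connection_form (coords (- a) 0 0) (coords (- b) 0 0) (coords 0 0 0)
  end.

Lemma class_connection_anti s a b i j k :
  class_connection s a b i k j = - class_connection s a b i j k.
Proof.
by case: s; rewrite /class_connection /connection_form !(wedge_anti _ _ j k); ring.
Qed.

(* In all classes the curvature operator on 2-vectors is diagonal up to its
   (E_0 /\ E_1, E_0 /\ E_2) entry [d]. *)
Definition curvature_form (a b c d : R) i j k l : R :=
  a * wedge 0 1 i j * wedge 0 1 k l + b * wedge 0 2 i j * wedge 0 2 k l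
  + c * wedge 1 2 i j * wedge 1 2 k l
  + (d * wedge 0 1 i j * wedge 0 2 k l + d * wedge 0 2 i j * wedge 0 1 k l).

Definition class_curvature s a b :=
  match s with
  | F1 => curvature_form 0 0 (a ^+ 2 + b ^+ 2) 0
  | F4 | F9 => curvature_form (a ^+ 2) (a ^+ 2) (- a ^+ 2) 0
  | F5 => curvature_form (a ^+ 2) (a ^+ 2) (a ^+ 2) 0
  | F8 => curvature_form (- a ^+ 2) (- a ^+ 2) (a ^+ 2) 0
  | F10 => curvature_form 0 0 0 0
  | F11 => curvature_form (a ^+ 2) (b ^+ 2) 0 (a * b)
  end.

(** A skew array on three indices has zero diagonal and three independent entries. *)
Lemma anti_ord3_ext (f h : 'I_3 -> 'I_3 -> R) :
  (forall i j, f j i = - f i j) -> (forall i j, h j i = - h i j) ->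
  f 0 1 = h 0 1 -> f 0 2 = h 0 2 -> f 1 2 = h 1 2 -> forall i j, f i j = h i j.
Proof.
move=> fA hA f01 f02 f12 i j.
have diag k : f k k = h k k by have := fA k k; have := hA k k; lra.
case: (ord3_cases i) => ->; case: (ord3_cases j) => -> //;
  by rewrite fA hA ?f01 ?f02 ?f12.
Qed.

Lemma riemann_antil Gamma i j k l :
  riemann Gamma j i k l = - riemann Gamma i j k l.
Proof. by rewrite /riemann; ring. Qed.

Lemma riemann_antir Gamma i j k l :
  (forall i j k, Gamma i k j = - Gamma i j k) ->
  riemann Gamma i j l k = - riemann Gamma i j k l.
Proof.
move=> GammaA; rewrite /riemann !sum_ord3.
by rewrite !(GammaA _ _ k) !(GammaA _ _ l) -!(GammaA _ k); ring.
Qed.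

Lemma curvature_form_anti (a b c d : R) i j k l :
  curvature_form a b c d j i k l = - curvature_form a b c d i j k l /\
  curvature_form a b c d i j l k = - curvature_form a b c d i j k l.
Proof.
by rewrite /curvature_form !(wedge_anti _ _ i j) !(wedge_anti _ _ k l); split; ring.
Qed.

(** Both sides are skew in (i, j) and in (k, l), so only the nine components with each pair among
    01, 02, 12 have to be computed. *)
Lemma riemann_class s a b i j k l :
  riemann (class_connection s a b) i j k l = class_curvature s a b i j k l.
Proof.
have GammaA := class_connection_anti s a b.
have RA i' j' k' l' : class_curvature s a b j' i' k' l'
      = - class_curvature s a b i' j' k' l' /\
    class_curvature s a b i' j' l' k' = - class_curvature s a b i' j' k' l'.
  by case: s {GammaA} => /=; exact: curvature_form_anti.
apply: (anti_ord3_ext (f := riemann (class_connection s a b) i j)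
  (h := class_curvature s a b i j)) => [k' l'|k' l'|||].
- exact: riemann_antir.
- exact: (RA _ _ _ _).2.
all: match goal with |- _ = class_curvature _ _ _ _ _ ?k' ?l' =>
  apply: (anti_ord3_ext
    (f := fun i j => riemann (class_connection s a b) i j k' l')
    (h := fun i j => class_curvature s a b i j k' l')) => [i' j'|i' j'|||] end.
all: try exact: riemann_antil.
all: try exact: (RA _ _ _ _).1.
all: rewrite /riemann !sum_ord3 {GammaA RA}.
all: case: s; rewrite /class_connection /class_curvature /curvature_form
  /connection_form /coords /wedge /=.
all: ring.
Qed.

Lemma curvature_form_support S (a b c d : R) :
  (a = 0) \/ ((0, 1, 0, 1) \in S) -> (b = 0) \/ ((0, 2, 0, 2) \in S) ->
  (c = 0) \/ ((1, 2, 1, 2) \in S) -> (d = 0) \/ ((0, 1, 0, 2) \in S) ->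
  curvature_support S (curvature_form a b c d).
Proof.
move=> Sa Sb Sc Sd; rewrite /curvature_form; split=> i j k l.
- by rewrite !(wedge_anti _ _ i j); ring.
- by rewrite !(wedge_anti _ _ k l); ring.
- by ring.
move=> notS.
(* A nonzero product of wedges forces (i, j) and (k, l) to be the given pairs up to order, hence an
   index in [S]. Both orders of the two wedges are treated because [d] multiplies both mixed
   terms. *)
have term0 x t u v w : x = 0 \/ (t, u, v, w) \in S ->
    x * wedge t u i j * wedge v w k l = 0 /\ x * wedge v w i j * wedge t u k l = 0.
  case=> [->|tuvw]; first by rewrite !mul0r.
  split; apply/eqP; rewrite !mulf_eq0 -orbA -[_ || _]negbK !negb_or.
    apply/negP => /and3P[_ /wedge_neq0 ij /wedge_neq0 kl].
    apply: (negP (notS (t, u, v, w) _) tuvw).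
    by case: ij => -[-> ->]; case: kl => -[-> ->];
    rewrite !inE eqxx ?orbT.
  apply/negP => /and3P[_ /wedge_neq0 ij /wedge_neq0 kl].
  apply: (negP (notS (t, u, v, w) _) tuvw).
  by case: ij => -[-> ->]; case: kl => -[-> ->];
    rewrite !inE eqxx ?orbT.
have [-> _] := term0 _ _ _ _ _ Sa; have [-> _] := term0 _ _ _ _ _ Sb.
have [-> _] := term0 _ _ _ _ _ Sc; have [-> ->] := term0 _ _ _ _ _ Sd.
by rewrite !addr0.
Qed.

(** * Ricci tensors, scalar curvatures and sectional curvatures of a curvature form *)

Lemma all_equal_to_cons (v x : R) (t : seq R) :
  x = v -> Defs.all_equal_to v t -> Defs.all_equal_to v (x :: t).
Proof. by move=> xv tv y /[1!inE] /predU1P[->//|/tv]. Qed.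

Lemma all_equal_to_nil (v : R) : Defs.all_equal_to v [::].
Proof. by []. Qed.

Definition sym_table (x00 x11 x22 x01 x02 x12 : R) (i j : 'I_3) : R :=
  nth 0 (nth [::] [:: [:: x00; x01; x02]; [:: x01; x11; x12];
                      [:: x02; x12; x22]] i) j.

Lemma sym_table_support S (x00 x11 x22 x01 x02 x12 : R) :
  x00 = 0 \/ ((0, 0) \in S) -> x11 = 0 \/ ((1, 1) \in S) ->
  x22 = 0 \/ ((2, 2) \in S) -> x01 = 0 \/ ((0, 1) \in S) ->
  x02 = 0 \/ ((0, 2) \in S) -> x12 = 0 \/ ((1, 2) \in S) ->
  symmetric_support S (sym_table x00 x11 x22 x01 x02 x12).
Proof.
move=> S00 S11 S22 S01 S02 S12; split=> i j;
  case: (ord3_cases i) => ->; case: (ord3_cases j) => -> //= /negP ? /negP ?.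
all: rewrite /sym_table /=; tauto.
Qed.

Lemma symmetric_plain_support S (T : 'I_3 -> 'I_3 -> R) :
  symmetric_support S T -> (forall i j, (j, i) \in S -> (i, j) \in S) ->
  plain_support S T.
Proof.
by move=> [_ ST] Ssym i j ijS; apply: ST => //; apply: contra ijS; exact: Ssym.
Qed.

Lemma symmetric_plane_support S (T : 'I_3 -> 'I_3 -> R) :
  symmetric_support S T -> plane_support S T.
Proof. by move=> [TC ST]; split=> i j _; [exact: TC | exact: ST]. Qed.

Lemma ricci_curvature_form (a b c d : R) j k :
  \sum_i curvature_form a b c d i j k i
  = sym_table (- (a + b)) (- (a + c)) (- (b + c)) 0 0 (- d) j k.
Proof.
rewrite sum_ord3 /curvature_form /wedge /sym_table.
by case: (ord3_cases j) => ->; case: (ord3_cases k) => -> /=; ring.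
Qed.

(** The two summands are the terms i = 1 and i = 2 of rho-star: phi exchanges E_1 and E_2 and kills
    E_0. *)
Lemma ricci_star_curvature_form (a b c d : R) j k :
  curvature_form a b c d 1 j k 2 + curvature_form a b c d 2 j k 1
  = sym_table (- 2 * d) 0 0 0 0 c j k.
Proof.
rewrite /curvature_form /wedge /sym_table.
by case: (ord3_cases j) => ->; case: (ord3_cases k) => -> /=; ring.
Qed.

Lemma sectional_curvature_form (a b c d : R) j k :
  curvature_form a b c d j k k j = sym_table 0 0 0 (- a) (- b) (- c) j k.
Proof.
rewrite /curvature_form /wedge /sym_table.
by case: (ord3_cases j) => ->; case: (ord3_cases k) => -> /=; ring.
Qed.

Lemma class_components_curvature s a b Rc rho rhos tau taus sec :
  (forall i j k l, Rc i j k l = class_curvature s a b i j k l) ->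
  (forall j k, rho j k = \sum_i Rc i j k i) ->
  (forall j k, rhos j k = Rc 1 j k 2 + Rc 2 j k 1) ->
  tau = \sum_i rho i i -> taus = \sum_i rhos i i ->
  (forall i j, sec i j = Rc i j j i) ->
  class_components s a b Rc rho rhos tau taus sec.
Proof.
move=> RcE rhoE rhosE -> -> secE; rewrite !sum_ord3.
have {}RcE : Rc = class_curvature s a b by do 4 apply/funext => ?; exact: RcE.
(* All tensors depend on the class only through the four coefficients of its curvature form, so they
   are tabulated once for every class. *)
have formE (x y z t : R) : class_curvature s a b = curvature_form x y z t ->
    [/\ Rc = curvature_form x y z t,
        rho = sym_table (- (x + y)) (- (x + z)) (- (y + z)) 0 0 (- t),
        rhos = sym_table (- 2 * t) 0 0 0 0 z
      & sec = sym_table 0 0 0 (- x) (- y) (- z)].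
  move=> cE; split; first by rewrite RcE.
  - do 2 apply/funext => ?; rewrite rhoE -ricci_curvature_form.
    by apply: eq_bigr => i _; rewrite RcE cE.
  - do 2 apply/funext => ?.
    by rewrite rhosE -(ricci_star_curvature_form x y) RcE cE.
  - do 2 apply/funext => ?.
    by rewrite secE -(sectional_curvature_form _ _ _ t) RcE cE.
(* These two lists are the supports of rho-star that occur; both are closed under transposition. *)
have Ssym (S : seq ('I_3 * 'I_3)) :
    S \in [:: [:: (1, 2); (2, 1)]; [:: (0, 0)]] ->
    forall i j, (j, i) \in S -> (i, j) \in S.
  move=> SS i j; case: (ord3_cases i) => ->; case: (ord3_cases j) => -> //;
  by move: SS; rewrite !inE => /orP[/eqP->|/eqP->].
case: s {RcE} formE => formE; rewrite /class_components //;
  have [-> -> -> ->] := formE _ _ _ _ erefl.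
all: repeat match goal with |- _ /\ _ => split | |- and4 _ _ _ _ => split
  | |- and5 _ _ _ _ _ => split end.
all: try by apply: curvature_form_support; first [by right | by left].
all: try by do ?apply: symmetric_plane_support; apply: sym_table_support;
  first [by right | left; ring].
all: try by apply: symmetric_plain_support;
  [apply: sym_table_support; first [by right | left; ring] | exact: Ssym].
all: repeat match goal with |- Defs.all_equal_to _ (_ :: _) =>
  apply: all_equal_to_cons end; try exact: all_equal_to_nil.
all: rewrite /curvature_form /wedge /sym_table /=.
all: by field.
Qed.

(** * Vanishing of the curvature or of F forces a zero connection *)

Lemma class_connection_eq0 s a b :
  a = 0 -> s <> F1 /\ s <> F11 \/ b = 0 ->
  forall i j k, class_connection s a b i j k = 0.
Proof.
move=> -> b0 i j k; have zero3 l : coords 0 0 0 l = 0.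
  by case: (ord3_cases l) => ->.
case: s b0 => [[[]//|->]|_|_|_|_|_|[[_ []//]|->]];
  by rewrite /= /connection_form ?oppr0 !zero3 !mul0r !addr0.
Qed.

(** Outside F_10 the diagonal curvature components are, up to sign, squares of the parameters or the
    sum of these squares, so over the reals they vanish only with the parameters. *)
Lemma class_curvature_eq0 s a b : s <> F10 ->
  (forall i j k l, class_curvature s a b i j k l = 0) ->
  forall i j k, class_connection s a b i j k = 0.
Proof.
move=> s10 R0; have sqr0 (x : R) : x ^+ 2 = 0 -> x = 0.
  by move/eqP; rewrite sqrf_eq0 => /eqP.
have a2 := sqr_ge0 a; have b2 := sqr_ge0 b.
suff [a0 b0] : a = 0 /\ (s <> F1 /\ s <> F11 \/ b = 0).
  exact: class_connection_eq0.
have := R0 0 1 0 1; have := R0 0 2 0 2; have := R0 1 2 1 2.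
case: s s10 {R0} => // _; rewrite /class_curvature /curvature_form /wedge /=
  => e1 e2 e3; split; try by left.
all: try by apply: sqr0; lra.
all: by right; apply: sqr0; lra.
Qed.

Lemma nabla_phi_eq0 s a b : s <> F10 ->
  (forall i j k, nabla_phi (class_connection s a b) i j k = 0) ->
  forall i j k, class_connection s a b i j k = 0.
Proof.
move=> s10 F0; suff [a0 b0] : a = 0 /\ (s <> F1 /\ s <> F11 \/ b = 0).
  exact: class_connection_eq0.
(* Up to nonzero factors, F_111 and F_211 give [a] and [b] in class F_1, F_101 gives [a] in F_4 and
   F_8, F_102 gives [a] in F_5 and F_9, and F_002 and F_001 give [a] and [b] in F_11. *)
have := F0 1 1 1; have := F0 2 1 1; have := F0 1 0 1; have := F0 1 0 2.
have := F0 0 0 1; have := F0 0 0 2.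
case: s s10 {F0} => // _; rewrite /nabla_phi !sum_ord3 /phi_coef
  /class_connection /connection_form /coords /wedge /=
  => e1 e2 e3 e4 e5 e6; split; try by left.
all: try lra.
all: by right; lra.
Qed.

Lemma basic_tensor_trilinear s (c : coefficients R) x y z :
  basic_tensor s c x y z = \sum_i \sum_j \sum_k x i * y j * z k
    * basic_tensor s c (fun l => (l == i)%:R) (fun l => (l == j)%:R)
        (fun l => (l == k)%:R).
Proof.
rewrite !sum_ord3.
by case: s => /=; ring.
Qed.
End Components.

(** * Invariant orthonormal frames *)

Section Frame.
Context {R : realType} {G : lie_group R} {E : 'I_3 -> vfield G}.
Context {phi : G -> {linear 'rV[R]_3 -> 'rV[R]_3}}.
Context {g : G -> 'rV[R]_3 -> 'rV[R]_3 -> R}.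
Context {nabla : vfield G -> vfield G -> vfield G}.
Context {Gamma : 'I_3 -> 'I_3 -> 'I_3 -> R}.
Hypothesis gR : riemannian_metric g.
Hypothesis lc : levi_civita g nabla.
Hypothesis sE : forall i, smooth_field (E i).
Hypothesis gE : forall i j p, g p (E i p) (E j p) = (i == j)%:R.
Implicit Types (X Y Z : vfield G) (u v w : 'rV[R]_3).

Lemma metricD p u v w : g p (u + v) w = g p u w + g p v w.
Proof. by rewrite -[u]scale1r (metric_linear gR) mul1r scale1r. Qed.

Lemma metric0 p w : g p 0 w = 0.
Proof. by have := metricD p 0 0 w; rewrite addr0; lra. Qed.

Lemma metricZ p a u w : g p (a *: u) w = a * g p u w.
Proof. by rewrite -[_ *: _]addr0 (metric_linear gR) metric0 addr0. Qed.

Lemma metricB p u v w : g p (u - v) w = g p u w - g p v w.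
Proof. by rewrite -scaleN1r metricD metricZ mulN1r. Qed.

Lemma metric_sum p (c : 'I_3 -> R) (V : 'I_3 -> 'rV[R]_3) w :
  g p (\sum_i c i *: V i) w = \sum_i c i * g p (V i) w.
Proof. by rewrite !sum_ord3 !metricD !metricZ. Qed.

Lemma metric_frame p (c : 'I_3 -> R) k : g p (\sum_i c i *: E i p) (E k p) = c k.
Proof.
rewrite metric_sum (bigD1 k) //= big1 => [|i /negbTE ik]; last first.
  by rewrite gE ik mulr0.
by rewrite gE eqxx mulr1 addr0.
Qed.

(** Pairing a linear relation with E_k kills its k-th coefficient, so the three orthonormal vectors
    are independent and hence span R^3; the coefficients are then read off with the metric. *)
Lemma frame_decomp p v : v = \sum_i g p v (E i p) *: E i p.
Proof.
pose M := \matrix_i E i p.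
have combE (c : 'rV[R]_3) : c *m M = \sum_i c 0 i *: E i p.
  by rewrite mulmx_sum_row; apply: eq_bigr => i _; rewrite rowK.
have freeM : row_free M.
  apply: inj_row_free => c cM; apply/rowP => k; rewrite mxE.
  by rewrite -(metric_frame p (c 0)) -combE cM metric0.
have fullM : M \in unitmx by rewrite -row_free_unit.
have vE : v = \sum_i (v *m invmx M) 0 i *: E i p by rewrite -combE mulmxKV.
rewrite {1}vE; apply: eq_bigr => i _; congr (_ *: _).
by rewrite [in RHS]vE metric_frame.
Qed.

Lemma frame_ext p u v : (forall k, g p u (E k p) = g p v (E k p)) -> u = v.
Proof.
move=> uv; rewrite (frame_decomp p u) (frame_decomp p v).
by apply: eq_bigr => i _; rewrite uv.
Qed.

Lemma frame_decomp_field X : X = fun q => \sum_i g q (X q) (E i q) *: E i q.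
Proof. by apply/funext => q; exact: frame_decomp. Qed.

(** A smooth field is a combination of the frame with coefficients g(X, E_i), which are smooth
    functions. *)
Lemma frame_ind (P : vfield G -> Prop) :
  (forall f X Y, smooth_fun [set: G] f -> smooth_field X -> smooth_field Y ->
     P X -> P Y -> P (fun q => f q *: X q + Y q)) ->
  (forall i, P (E i)) -> forall X, smooth_field X -> P X.
Proof.
move=> Plin PE X sX; rewrite (frame_decomp_field X).
have sg i := metric_smooth gR sX (sE i).
(* The zero field in the form -E_0 + E_0, so that [Plin] and [PE] give the start of the sum. *)
pose X0 : vfield G := fun q => (-1) *: E 0 q + E 0 q.
have sN1 : smooth_fun [set: G] (fun=> -1) by exact: smooth_fun_cst.
have sX0 : smooth_field X0 := smooth_field_linear sN1 (sE 0) (sE 0).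
have PX0 : P X0 := Plin _ _ _ sN1 (sE 0) (sE 0) (PE 0) (PE 0).
have sX2 := smooth_field_linear (sg 2) (sE 2) sX0.
have sX1 := smooth_field_linear (sg 1) (sE 1) sX2.
have PX2 := Plin _ _ _ (sg 2) (sE 2) sX0 (PE 2) PX0.
have PX1 := Plin _ _ _ (sg 1) (sE 1) sX2 (PE 1) PX2.
have := Plin _ _ _ (sg 0) (sE 0) sX1 (PE 0) PX1.
congr P; apply/funext => q.
by rewrite sum_ord3 /X0 scaleN1r addNr addr0 addrA.
Qed.

Lemma nabla_comb X (c : 'I_3 -> R) : smooth_field X ->
  nabla X (fun q => \sum_k c k *: E k q) = fun q => \sum_k c k *: nabla X (E k) q.
Proof.
move=> sX; have scE k : smooth_field (fun q => c k *: E k q).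
  exact: smooth_fieldZ (smooth_fun_cst (c k)) (sE k).
have nablaZ k q : nabla X (fun q => c k *: E k q) q = c k *: nabla X (E k) q.
  rewrite (nabla_leibniz lc (smooth_fun_cst (c k)) sX (sE k)).
  by rewrite act_cst scale0r add0r.
apply/funext => q; rewrite sum_ord3.
have -> : (fun q => \sum_k c k *: E k q)
    = fun q => (fun r => c 0 *: E 0 r + c 1 *: E 1 r) q + c 2 *: E 2 q.
  by apply/funext => r; rewrite sum_ord3.
rewrite (nabla_addr lc sX (smooth_fieldD (scE 0) (scE 1)) (scE 2)).
by rewrite (nabla_addr lc sX (scE 0) (scE 1)) !nablaZ.
Qed.

Hypothesis Gamma_anti : forall i j k, Gamma i k j = - Gamma i j k.
Hypothesis bracketE : forall i j p,
  lie_bracket (E i) (E j) p = \sum_k (Gamma i j k - Gamma j i k) *: E k p.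

Lemma nabla_frame i j : nabla (E i) (E j) = fun p => \sum_k Gamma i j k *: E k p.
Proof.
apply/funext => p; apply: (@frame_ext p) => l; rewrite /= metric_frame.
(* The difference with [Gamma] is skew in (j, k) by metric compatibility and
   symmetric in (i, j) by torsion-freeness, hence zero. *)
pose D i j k := g p (nabla (E i) (E j) p) (E k p) - Gamma i j k.
have Danti a b c : D a c b = - D a b c.
  rewrite /D Gamma_anti; have := nabla_metric lc (sE a) (sE b) (sE c) p.
  have -> : (fun q => g q (E b q) (E c q)) = fun=> (b == c)%:R.
    by apply/funext => q; rewrite gE.
  rewrite act_cst (Defs.metric_sym gR p (E b p)); lra.
have Dsym a b c : D a b c = D b a c.
  have := congr1 (fun F : vfield G => g p (F p) (E c p))
    (lie_bracket_nabla lc (sE a) (sE b)).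
  by rewrite bracketE metric_frame metricB /D; lra.
suff : D i j l = 0 by rewrite /D; lra.
(* The chain is D_ijl = D_jil = -D_jli = -D_lji = D_lij = D_ilj = -D_ijl. *)
have := Danti i j l; have := Danti j i l; have := Danti l i j.
have := Dsym i j l; have := Dsym j l i; have := Dsym l i j.
by lra.
Qed.

Lemma curvature4_frame i j k l p :
  curvature4 g nabla (E i) (E j) (E k) (E l) p = riemann Gamma i j k l.
Proof.
have nablal (c : 'I_3 -> R) : nabla (fun p => \sum_m c m *: E m p) (E k) p
    = \sum_m c m *: nabla (E m) (E k) p.
  have sc m : smooth_fun [set: G] (fun=> c m) by exact: smooth_fun_cst.
  have sZ m := smooth_fieldZ (sc m) (sE m).
  have -> : (fun q => \sum_k c k *: E k q)
      = fun q => (fun r => c 0 *: E 0 r + c 1 *: E 1 r) q + c 2 *: E 2 q.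
    by apply/funext => r; rewrite sum_ord3.
  rewrite (nabla_addl lc (smooth_fieldD (sZ 0) (sZ 1)) (sZ 2) (sE k)).
  rewrite (nabla_addl lc (sZ 0) (sZ 1) (sE k)) sum_ord3.
  by rewrite !(nabla_scalel lc (sc _) (sE _) (sE k)).
rewrite /curvature4 (curvatureE lc (sE i) (sE j) (sE k)).
rewrite (nabla_frame j k) (nabla_frame i k) (nabla_frame i j) (nabla_frame j i).
rewrite !nabla_comb // !nablal !metricB !metric_sum /riemann.
do !congr (_ - _); apply: eq_bigr => m _;
  by rewrite nabla_frame metric_frame.
Qed.

(** The components are constant, so one point suffices in one direction; in the other, frame fields
    are replaced by arbitrary smooth fields one argument at a time. *)
Lemma flat_riemann :
  flat nabla <-> forall i j k l, riemann Gamma i j k l = 0.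
Proof.
split=> [flatn i j k l|R0].
  rewrite -(curvature4_frame i j k l 1%g) /curvature4 flatn ?metric0 //; exact: sE.
have flatE i j k p : curvature nabla (E i) (E j) (E k) p = 0.
  apply: (@frame_ext p) => l; rewrite metric0.
  by have := curvature4_frame i j k l p; rewrite R0.
have flat1 j k X : smooth_field X -> forall p, curvature nabla X (E j) (E k) p = 0.
  move: X; apply:
    (@frame_ind (fun X => forall p, curvature nabla X (E j) (E k) p = 0)).
    move=> f X Y sf sX sY IX IY p.
    by rewrite (curvature_linear1 lc p sf sX sY (sE j) (sE k)) IX IY scaler0 addr0.
  by move=> i; exact: flatE.
have flat2 X k Y : smooth_field X -> smooth_field Y ->
    forall p, curvature nabla X Y (E k) p = 0.
  move=> sX; move: Y; apply:
    (@frame_ind (fun Y => forall p, curvature nabla X Y (E k) p = 0)).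
    move=> f Y Y' sf sY sY' IY IY' p.
    by rewrite (curvature_linear2 lc p sf sX sY sY' (sE k)) IY IY' scaler0 addr0.
  by move=> i; exact: flat1.
move=> X Y + sX sY; apply:
  (@frame_ind (fun Z => forall p, curvature nabla X Y Z p = 0)).
  move=> f Z Z' sf sZ sZ' IZ IZ' p.
  by rewrite (curvature_linear3 lc p sf sX sY sZ sZ') IZ IZ' scaler0 addr0.
by move=> i; exact: flat2.
Qed.

Hypothesis phiE : forall p,
  [/\ phi p (E 0 p) = 0, phi p (E 1 p) = E 2 p & phi p (E 2 p) = E 1 p].

Lemma phi_frame j p : phi p (E j p) = \sum_m phi_coef j m *: E m p.
Proof.
have [phi0 phi1 phi2] := phiE p.
rewrite sum_ord3 /phi_coef; case: (ord3_cases j) => -> /=;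
  by rewrite ?phi0 ?phi1 ?phi2 !(scale0r, scale1r, add0r, addr0).
Qed.

Lemma Ftensor_frame i j k p :
  Ftensor phi g nabla (E i) (E j) (E k) p = nabla_phi Gamma i j k.
Proof.
have phiEj : (fun q => phi q (E j q)) = fun q => \sum_m phi_coef j m *: E m q.
  by apply/funext => q; exact: phi_frame.
rewrite /Ftensor phiEj nabla_comb // nabla_frame linear_sum metricB metric_sum.
congr (_ - _).
  by apply: eq_bigr => m _; rewrite nabla_frame metric_frame.
under eq_bigr do rewrite linearZ /=.
rewrite metric_sum; apply: eq_bigr => m _.
by rewrite phi_frame metric_frame.
Qed.

(** Class membership already expresses F through a trilinear form in the components of its
    arguments, so F vanishes once it does on the frame. *)
Lemma F0_nabla_phi s : in_class E phi g nabla s ->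
  F0_manifold phi g nabla <-> forall i j k, nabla_phi Gamma i j k = 0.
Proof.
move=> [c Fc]; split=> [F0 i j k|F0 X Y Z sX sY sZ p].
  by rewrite -(Ftensor_frame i j k 1%g) F0.
(* Constant Kronecker coefficients turn the class formula into a statement about the frame fields
   themselves. *)
pose d (i : 'I_3) : 'I_3 -> G -> R := fun l => fun=> (l == i)%:R.
have combd i : (fun q => \sum_l d i l q *: E l q) = E i.
  apply/funext => q; rewrite (bigD1 i) //= big1 => [|l /negbTE li].
    by rewrite /d eqxx scale1r addr0.
  by rewrite /d li scale0r.
have basic0 i j k : basic_tensor s c (fun l => (l == i)%:R)
    (fun l => (l == j)%:R) (fun l => (l == k)%:R) = 0.
  rewrite -(F0 i j k) -(Ftensor_frame i j k p).
  have <- := Fc (d i) (d j) (d k) _ p; first by rewrite !combd.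
  by move=> l; split; exact: smooth_fun_cst.
rewrite (frame_decomp_field X) (frame_decomp_field Y) (frame_decomp_field Z).
have scoords i := And3 (metric_smooth gR sX (sE i)) (metric_smooth gR sY (sE i))
  (metric_smooth gR sZ (sE i)).
rewrite (Fc _ _ _ scoords p).
rewrite basic_tensor_trilinear big1 // => i _; rewrite big1 // => j _.
by rewrite big1 // => k _; rewrite basic0 mulr0.
Qed.

End Frame.

(** * From the brackets of each class to flatness and the curvature components *)

Lemma class_brackets_connection (R : realType) (G : lie_group R)
    (E : 'I_3 -> vfield G) (g : G -> 'rV[R]_3 -> 'rV[R]_3 -> R)
    (nabla : vfield G -> vfield G -> vfield G) (s : basic_class) (a b : R) :
  levi_civita g nabla -> (forall i, smooth_field (E i)) ->
  class_brackets E s a b -> forall i j p,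
  lie_bracket (E i) (E j) p = \sum_k
    (class_connection s a b i j k - class_connection s a b j i k) *: E k p.
Proof.
move=> lc sE br i j p; apply/rowP => l.
pose L (u v : 'I_3) : R := lie_bracket (E u) (E v) p 0 l.
pose S (u v : 'I_3) : R := (\sum_k
  (class_connection s a b u v k - class_connection s a b v u k) *: E k p) 0 l.
(* Both sides are skew in the two frame indices, which leaves the three brackets prescribed by the
   class. *)
have LA u v : L v u = - L u v.
  by rewrite /L (lie_bracket_anti lc (sE v) (sE u)) mxE.
have SA u v : S v u = - S u v.
  by rewrite /S !sum_ord3 !mxE; ring.
apply: (anti_ord3_ext (f := L) (h := S)) => //; rewrite /L /S {L S LA SA}.
all: case: s br => -[br01 br02 br12]; rewrite ?br01 ?br02 ?br12 !sum_ord3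
  /class_connection /connection_form /coords /wedge /= !mxE; ring.
Qed.

Theorem theorem2p8 (R : realType) (G : lie_group R) (E : 'I_3 -> vfield G)
    (phi : G -> {linear 'rV[R]_3 -> 'rV[R]_3}) (xi : vfield G)
    (eta : G -> {scalar 'rV[R]_3}) (g : G -> 'rV[R]_3 -> 'rV[R]_3 -> R)
    (nabla : vfield G -> vfield G -> vfield G)
    (s : basic_class) (alpha beta : R) :
  left_invariant_basis E ->
  riemannian_metric g ->
  adapted_structure E phi xi eta g ->
  levi_civita g nabla ->
  in_class E phi g nabla s ->
  class_brackets E s alpha beta ->
  [/\ s = F10 -> flat nabla,
      s <> F10 -> (flat nabla <-> F0_manifold phi g nabla)
    & s <> F10 -> forall p : G,
        class_components s alpha beta
          (fun i j k l => curvature4 g nabla (E i) (E j) (E k) (E l) p)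
          (fun j k => ricci E g nabla (E j) (E k) p)
          (fun j k => ricci_star E phi g nabla (E j) (E k) p)
          (scal E g nabla p)
          (scal_star E phi g nabla p)
          (fun i j => sectional E g nabla i j p)].
Proof.
move=> [Einv _] gR [phiE _ _ gE] lc Fs br.
have sE i : smooth_field (E i) by have [] := Einv i.
have brE := class_brackets_connection lc sE br.
have GammaA := class_connection_anti s alpha beta.
have flatE := flat_riemann gR lc sE gE GammaA brE.
have F0E := F0_nabla_phi gR lc sE gE GammaA brE phiE Fs.
have RE := curvature4_frame gR lc sE gE GammaA brE.
split=> [s10|s10|_ p].
- apply/flatE => i j k l; rewrite riemann_class s10 /= /curvature_form; ring.
(* Either condition makes all connection components vanish, and these determine both the curvature
   and F. *)
- split=> [/flatE R0|/F0E F0].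
    have Gamma0 : forall i j k, class_connection s alpha beta i j k = 0.
      by apply: class_curvature_eq0 => // i j k l; rewrite -riemann_class.
    apply/F0E => i j k; rewrite /nabla_phi !big1 ?subrr // => m _;
      by rewrite Gamma0 ?mulr0 ?mul0r.
  have Gamma0 := nabla_phi_eq0 s10 F0.
  apply/flatE => i j k l; rewrite /riemann !big1 ?subrr // => m _;
    by rewrite Gamma0 mul0r.
apply: class_components_curvature => //.
  by move=> i j k l; rewrite RE riemann_class.
move=> j k; have [phi0 phi1 phi2] := phiE p.
(* Removes the i = 0 term from rho-star. *)
have g0 (v : 'rV[R]_3) : g p v (phi p (E 0 p)) = 0.
  by rewrite phi0 (Defs.metric_sym gR); exact: metric0.
rewrite /ricci_star sum_ord3 -[RHS]add0r addrA /curvature4.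
by congr (_ + _ + _); rewrite ?g0 ?phi1 ?phi2.
Qed.
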